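(* Let $\circ\in\{\cap,\cup,\oplus\}$ and let $m,n,p\geq 3$ be integers. Then $$\mathrm{sc}_{(\star\cdot\star)\circ\star}(m,n,p)=\left((m-1)2^{n}+2^{n-1}\right)p.$$ The bound is reached by the triple of languages over the two-letter alphabet $\{a,b\}$ recognized by the automata $$\left(\mathcal X_{m}(a,b,-;\emptyset),\ \mathcal X_{n}(a,-,b;\emptyset),\ \mathcal X_{p}(b,a,-;\emptyset)\right);$$ that is, writing $L_1,L_2,L_3$ for these languages, $\mathrm{sc}((L_1\cdot L_2)\circ L_3)=((m-1)2^{n}+2^{n-1})p$.
   Context: For a regular language $L$ over a finite alphabet $\Sigma$, $\mathrm{sc}(L)$ denotes the number of states of its minimal complete deterministic finite automaton (DFA) over $\Sigma$. For a ternary operation $\otimes$ on languages, $\mathrm{sc}_\otimes(m,n,p)=\max \mathrm{sc}(\otimes(L_1,L_2,L_3))$, the maximum being over all finite alphabets $\Sigma$ and all regular languages $L_1,L_2,L_3$ over the same alphabet $\Sigma$ with $\mathrm{sc}(L_1)=m$, $\mathrm{sc}(L_2)=n$, $\mathrm{sc}(L_3)=p$. The operation $(\star\cdot\star)\circ\star$ is $(L_1,L_2,L_3)\mapsto (L_1\cdot L_2)\circ L_3$, where $\cdot$ is catenation; $\oplus$ is symmetric difference. $\mathcal X_n(\sigma_1,\sigma_2,\sigma_3;\Sigma\setminus\{\sigma_1,\sigma_2,\sigma_3\})$ is the complete DFA over $\Sigma$ with state set $\{0,\dots,n-1\}$, initial state $0$, unique final state $n-1$, in which the letter $\sigma_1$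 acts as the cycle $(0,1,\dots,n-1)$ (i.e. $q\mapsto q+1 \bmod n$), $\sigma_2$ acts as the transposition exchanging $0$ and $1$, $\sigma_3$ acts as the contraction sending $1$ to $0$ and fixing all other states, and all other letters act as the identity; a ''$-$'' in place of $\sigma_i$ means that no letter plays that role. *)

(* Defs.v *)
From mathcomp Require Import all_boot all_fingroup.

Set Implicit Arguments.
Unset Strict Implicit.
Unset Printing Implicit Defensive.

(* Membership is boolean; no regular language is lost, since a DFA decides
   membership.  Equality of languages is the extensional [=1]. *)
Definition language (A : finType) := pred (seq A).

Record dfa (A : finType) := DFA {
  state : finType;
  init : state;
  final : {set state};
  trans : state -> A -> state }.

Definition lang (A : finType) (M : dfa A) : language A :=
  fun w => foldl (@trans A M) (init M) w \in final M.

Definition minimal (A : finType) (M : dfa A) : Prop :=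
  forall N : dfa A, lang N =1 lang M -> #|state M| <= #|state N|.

(* [has_sc L k] reads: L is regular and sc(L) = k. *)
Definition has_sc (A : finType) (L : language A) (k : nat) : Prop :=
  exists M : dfa A, [/\ lang M =1 L, minimal M & #|state M| = k].

Definition conc (A : finType) (L1 L2 : language A) : language A :=
  fun w => [exists i : 'I_(size w).+1, L1 (take i w) && L2 (drop i w)].

Lemma concP (A : finType) (L1 L2 : language A) (w : seq A) :
  reflect (exists u v, [/\ w = u ++ v, L1 u & L2 v]) (conc L1 L2 w).
Proof.
apply: (iffP existsP) => [[i /andP[L1u L2v]] | [u [v [-> L1u L2v]]]].
  by exists (take i w), (drop i w); rewrite cat_take_drop.
have lt_u : size u < (size (u ++ v)).+1 by rewrite ltnS size_cat leq_addr.
by exists (Ordinal lt_u); rewrite /= take_size_cat // drop_size_cat // L1u.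
Qed.

Inductive bool_op := Inter | Union | SymDiff.

Definition bool_lang (o : bool_op) (A : finType) (L1 L2 : language A) :
    language A :=
  fun w => match o with
           | Inter => L1 w && L2 w
           | Union => L1 w || L2 w
           | SymDiff => L1 w (+) L2 w
           end.

Definition ternary_op :=
  forall A : finType, language A -> language A -> language A -> language A.

Definition conc_bool (o : bool_op) : ternary_op :=
  fun A L1 L2 L3 => bool_lang o (conc L1 L2) L3.

(* [has_sc_op op m n p N] reads: the maximum sc_op(m,n,p) exists and is N.
   The second clause also asserts that the resulting language is regular. *)
Definition has_sc_op (op : ternary_op) (m n p N : nat) : Prop :=
  (exists (A : finType) (L1 L2 L3 : language A),
      [/\ has_sc L1 m, has_sc L2 n, has_sc L3 p & has_sc (op A L1 L2 L3) N]) /\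
  (forall (A : finType) (L1 L2 L3 : language A),
      has_sc L1 m -> has_sc L2 n -> has_sc L3 p ->
      exists2 k, has_sc (op A L1 L2 L3) k & k <= N).

(* X_n(s1, s2, s3; all other letters), with [None] for "-".  The hypothesis
   1 < n makes the states 0 and 1 available; [ordS] is q |-> q+1 mod n.  The
   letters given for the three roles are meant to be distinct. *)
Definition Xdfa (n : nat) (n_gt1 : 1 < n) (A : finType) (s1 s2 s3 : option A) :
    dfa A :=
  let zero : 'I_n := Ordinal (ltnW n_gt1) in
  let one : 'I_n := Ordinal n_gt1 in
  @DFA A 'I_n zero [set q : 'I_n | q == n.-1 :> nat]
    (fun q x =>
       if Some x == s1 then ordS q
       else if Some x == s2 then tperm zero one q
       else if Some x == s3 then (if q == one then zero else q)
       else q).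

(* The two-letter alphabet {a, b} is encoded as bool. *)
Definition a : bool := true.
Definition b : bool := false.

(* Main.v *)
(* Upper bound: reading w, a DFA for (L1 . L2) o L3 needs only the state of M1,
   the set of states of M2 reached after the prefixes of w in L1, and the state
   of M3; when the state of M1 is final that set contains the initial state of
   M2.  With one final state in M1 this leaves the announced number of states.

   Reachability of (i, S, k) in the witness is by induction on |S|.  Every state
   with i = m-1 is reached by a from one with a smaller set, since a inserts 0;
   a further letter a gives all (0, S, k) with 1 in S.  When 1 is not in S, the
   word ab keeps i = 0 and shifts S, so S can be rotated until it contains 1;
   powers of a then reach the other i < m-1.

   Distinguishability: b preserves the membership of n-1 in S and cycles k, so a
   final power of b puts k wherever the Boolean operation needs it.  Powers of a
   bring an element that separates two sets to n-1, before the inserted 0's can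
   get there.  The powers of ab eventually collapse S into {0} while fixing i = 0
   and rotating the other i; this turns a difference in i into one in S. *)

Require Import Defs.
From mathcomp Require Import all_boot all_fingroup.
From mathcomp Require Import zify.
From Stdlib Require Import Classical.

Set Implicit Arguments.
Unset Strict Implicit.
Unset Printing Implicit Defensive.

(** * Automata in general: runs, state complexity and its lower bound *)

Section Generic.
Variable A : finType.
Implicit Types (L : language A) (M : dfa A) (w : seq A).

Definition run M (q : state M) w : state M := foldl (@trans A M) q w.

Lemma run_cat M (q : state M) u v : run q (u ++ v) = run (run q u) v.
Proof. exact: foldl_cat. Qed.

Lemma run_rcons M (q : state M) w x : run q (rcons w x) = trans (run q w) x.
Proof. exact: foldl_rcons. Qed.

Lemma eq_has_sc L L' k : L =1 L' -> has_sc L k -> has_sc L' k.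
Proof. by move=> eqL [M [ML minM cM]]; exists M; split=> // w; rewrite ML. Qed.

(** Strong induction on the number of states: a DFA that is not minimal has a strictly smaller
    equivalent one. Excluded middle decides minimality. *)
Lemma has_sc_leq M L : lang M =1 L -> exists2 k, has_sc L k & k <= #|state M|.
Proof.
have [c] := ubnP #|state M|; elim: c M => // c IH M; rewrite ltnS => leMc ML.
have [minM | /not_all_ex_not[N nN]] := classic (minimal M).
  by exists #|state M| => //; exists M.
have [NM /negP] := imply_to_and _ _ nN; rewrite -ltnNge => ltNM.
have NL w : lang N w = L w by rewrite NM.
have [k Lk le_kN] := IH N (leq_trans ltNM leMc) NL.
by exists k => //; apply: leq_trans le_kN (ltnW ltNM).
Qed.

Section SubDfa.
Variables (M : dfa A) (V : {set state M}).
Hypothesis init_V : init M \in V.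
Hypothesis trans_V : forall q x, q \in V -> trans q x \in V.

(** Any closed set of states is allowed, so the upper bound can be counted on [prod_valid] without
    computing its reachable part. *)
Definition sub_dfa : dfa A :=
  @DFA A {q | q \in V} (exist _ (init M) init_V) [set q | val q \in final M]
    (fun q x => exist _ (trans (val q) x) (trans_V x (valP q))).

Lemma lang_sub_dfa : lang sub_dfa =1 lang M.
Proof.
move=> w; rewrite /lang inE -!/(run _ _).
suff -> : val (run (init sub_dfa) w) = run (init M) w by [].
by elim/last_ind: w => //= w x IH; rewrite !run_rcons /= -IH.
Qed.

Lemma card_sub_dfa : #|state sub_dfa| = #|V|.
Proof. by rewrite card_sig; apply: eq_card. Qed.
End SubDfa.

(** The lower-bound half of Myhill-Nerode: choose for each state in [V] a word leading to it, and
    run [N] on that word. Two states with the same image would agree on every continuation, so the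
    map is injective on [V]. *)
Lemma leq_card_states M (V : {set state M}) N :
    lang N =1 lang M ->
    (forall q, q \in V -> exists w, run (init M) w = q) ->
    (forall q r, q \in V -> r \in V -> q != r ->
       exists w, (run q w \in final M) != (run r w \in final M)) ->
  #|V| <= #|state N|.
Proof.
move=> NM reachV distV.
have /fin_all_exists[f fP] q : exists w, q \in V -> run (init M) w = q.
  by have [/reachV[w]|] := boolP (q \in V); [exists w | exists [::]].
rewrite -(@card_in_imset _ _ (fun q => run (init N) (f q))) ?max_card //.
move=> q r qV rV eq_qr; apply/eqP/negPn/negP => /(distV q r qV rV)[w].
have langf z : z \in V -> (run z w \in final M) = lang N (f z ++ w).
  by move=> zV; rewrite NM -{1}(fP z zV) -run_cat.
rewrite !langf // /lang -!/(run _ _) !run_cat.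
by rewrite eq_qr eqxx.
Qed.

Lemma minimal_dfa M :
    (forall q, exists w, run (init M) w = q) ->
    (forall q r : state M, q != r ->
       exists w, (run q w \in final M) != (run r w \in final M)) ->
  minimal M.
Proof.
move=> reachM distM N NM; rewrite -cardsT.
by apply: leq_card_states => // q r _ _; apply: distM.
Qed.

Lemma eq_conc_bool o L1 L2 L3 L1' L2' L3' :
    L1 =1 L1' -> L2 =1 L2' -> L3 =1 L3' ->
  conc_bool o L1 L2 L3 =1 conc_bool o L1' L2' L3'.
Proof.
move=> e1 e2 e3 w; rewrite /conc_bool /bool_lang e3.
suff -> : conc L1 L2 w = conc L1' L2' w by [].
by apply: eq_existsb => i; rewrite e1 e2.
Qed.

Definition bool_of (o : bool_op) (s t : bool) : bool :=
  match o with Inter => s && t | Union => s || t | SymDiff => s (+) t end.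

(** * The product automaton and the upper bound *)

Section Product.
Variables (o : bool_op) (M1 M2 M3 : dfa A).

Definition fresh (q : state M1) : {set state M2} :=
  if q \in final M1 then [set init M2] else set0.

(* The second component of a state collects the states that M2 may have
   reached after every prefix in the language of M1. *)
Definition prod_dfa : dfa A :=
  @DFA A (state M1 * {set state M2} * state M3)%type
    (init M1, fresh (init M1), init M3)
    [set q : (state M1 * {set state M2} * state M3)%type
       | bool_of o [exists r in q.1.2, r \in final M2] (q.2 \in final M3)]
    (fun q x => (trans q.1.1 x,
                 [set trans r x | r in q.1.2] :|: fresh (trans q.1.1 x),
                 trans q.2 x)).

Definition prod_valid : {set state prod_dfa} :=
  setX [set q : (state M1 * {set state M2})%type
          | (q.1 \in final M1) ==> (init M2 \in q.2)] setT.

Lemma in_fresh q r : (r \in fresh q) = (q \in final M1) && (r == init M2).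
Proof. by rewrite /fresh; case: ifP; rewrite inE. Qed.

Lemma run_prod (q : state prod_dfa) w :
  run q w = (run q.1.1 w, (run q w).1.2, run q.2 w).
Proof.
case: q => [[q S] r]; elim/last_ind: w => //= w x IH.
by rewrite !run_rcons {1}IH /=; congr (_, _, _); rewrite IH.
Qed.

Lemma run_prod_fst (q : state prod_dfa) w : (run q w).1.1 = run q.1.1 w.
Proof. by rewrite run_prod. Qed.

Lemma run_prod_snd (q : state prod_dfa) w : (run q w).2 = run q.2 w.
Proof. by rewrite run_prod. Qed.

Lemma mem_run_prod w r :
  r \in (run (init prod_dfa) w).1.2 <->
  exists u v, [/\ w = u ++ v, lang M1 u & run (init M2) v = r].
Proof.
elim/last_ind: w r => [|w x IH] r.
  rewrite /= in_fresh; split=> [/andP[fi /eqP->] | [u [v [/esym/nilP]]]].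
    by exists [::], [::].
  rewrite /nilp size_cat addn_eq0 => /andP[/nilP-> /nilP->] fi <-.
  by rewrite eqxx andbT.
rewrite run_rcons run_prod /= !inE in_fresh -run_rcons; split.
  case/orP=> [/imsetP[s /IH[u [v [-> L1u <-]]] ->] | /andP[fi /eqP->]].
    by exists u, (rcons v x); rewrite rcons_cat run_rcons.
  by exists (rcons w x), [::]; rewrite cats0.
(* Either [v] is empty and the run of [M2] has just started, or the last letter prolongs a run
   already recorded. *)
case=> u [v]; case/lastP: v => [|v y] [].
  by rewrite cats0 => -> L1w <-; apply/orP; right; rewrite eqxx andbT.
rewrite -rcons_cat run_rcons => /rcons_inj[ew ->] L1u <-.
apply/orP; left; apply/imsetP; exists (run (init M2) v) => //.
by apply/IH; exists u, v.
Qed.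

Lemma lang_prod_dfa :
  lang prod_dfa =1 conc_bool o (lang M1) (lang M2) (lang M3).
Proof.
move=> w; rewrite {1}/lang -/(run _ _) inE.
have -> : [exists r in (run (init prod_dfa) w).1.2, r \in final M2]
            = conc (lang M1) (lang M2) w.
  apply/exists_inP/concP => [[r /mem_run_prod[u [v [-> L1u <-]]] fr] |].
    by exists u, v.
  move=> [u [v [-> L1u L2v]]]; exists (run (init M2) v) => //.
  by apply/mem_run_prod; exists u, v.
by rewrite run_prod.
Qed.

Lemma init_prod_valid : init prod_dfa \in prod_valid.
Proof. by rewrite !inE /= andbT in_fresh eqxx andbT implybb. Qed.

Lemma trans_prod_valid q x : q \in prod_valid -> trans q x \in prod_valid.
Proof.
move=> _; rewrite !inE /= andbT in_fresh eqxx andbT.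
by apply/implyP=> ->; rewrite orbT.
Qed.

Lemma card_prod_valid :
  #|prod_valid| = ((#|state M1| - #|final M1|) * 2 ^ #|state M2|
                   + #|final M1| * 2 ^ (#|state M2| - 1)) * #|state M3|.
Proof.
rewrite cardsX cardsT; congr (_ * _).
rewrite -sum1dep_card -(pair_big_dep xpredT
  (fun (q : state M1) (S : {set state M2}) =>
     (q \in final M1) ==> (init M2 \in S)) (fun _ _ => 1)) /=.
rewrite (bigID (mem (final M1))) /= addnC; congr (_ + _).
  rewrite (eq_bigr (fun=> 2 ^ #|state M2|)) => [|q /negPf->].
    rewrite sum_nat_const; congr (_ * _).
    by rewrite -(cardC (final M1)) addKn; apply: eq_card.
  rewrite /= sum1_card -(cardsT (state M2)) -card_powerset powersetT cardsT.
  exact: eq_card.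
rewrite (eq_bigr (fun=> 2 ^ (#|state M2| - 1))) => [|q ->].
  by rewrite sum_nat_const.
rewrite /= sum1dep_card subn1 -(cardC1 (init M2)) -[#|predC1 _|]cardsE.
rewrite -card_powerset.
(* Complementation matches the sets containing [init M2] with the sets avoiding it. *)
rewrite -(card_imset (mem (powerset _)) (inv_inj (@setCK _))).
apply: eq_card => S; rewrite !inE; apply/idP/imsetP => [iS | [T sT ->]].
  exists (~: S); rewrite ?setCK // inE; apply/subsetP=> r; rewrite !inE.
  by apply: contraNneq => ->.
move: sT; rewrite !inE => /subsetP sT; apply/negP=> /sT.
by rewrite !inE eqxx.
Qed.

Lemma has_sc_prod_leq (m n p : nat) :
    1 < m -> #|state M1| = m -> #|state M2| = n -> #|state M3| = p ->
  exists2 k, has_sc (conc_bool o (lang M1) (lang M2) (lang M3)) k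
           & k <= ((m - 1) * 2 ^ n + 2 ^ (n - 1)) * p.
Proof.
move=> m_gt1 c1 c2 c3.
suff [V [iV tV leV]] : exists V : {set state prod_dfa},
    [/\ init prod_dfa \in V, forall q x, q \in V -> trans q x \in V
      & #|V| <= ((m - 1) * 2 ^ n + 2 ^ (n - 1)) * p].
  have [k Lk le_k] := has_sc_leq (lang_sub_dfa iV tV).
  exists k; first exact: eq_has_sc lang_prod_dfa Lk.
  by rewrite (leq_trans le_k) // card_sub_dfa.
have n_gt0 : 0 < n by rewrite -c2; apply/card_gt0P; exists (init M2).
have e2 : 2 ^ n = 2 ^ (n - 1) + 2 ^ (n - 1).
  by rewrite addnn -mul2n -expnS subn1 prednK.
have pos2 : 0 < 2 ^ (n - 1) by rewrite expn_gt0.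
(* With no final state in [M1], [prod_valid] has m 2^n p elements, more than the bound; but then the
   second component stays empty and m p states suffice. *)
have [f0 | f_gt0] := posnP #|final M1|.
  have fr0 q : fresh q = set0 by rewrite /fresh (card0_eq f0).
  exists (setX (setX setT [set set0]) setT); split.
  - by rewrite !inE /= fr0 eqxx.
  - move=> [[q S] r] x; rewrite !inE /= !andbT fr0 => /eqP->.
    by rewrite imset0 setU0.
  apply: leq_trans (eq_leq (cardsX _ _)) _.
  rewrite cardsX !cardsT cards1 c1 c3 muln1 leq_mul2r; apply/orP; right.
  case: m m_gt1 {c1} => // m _; rewrite subn1 /= e2.
  by rewrite -addn1 leq_add // leq_pmulr // addn_gt0 pos2.
exists prod_valid; split; [exact: init_prod_valid | exact: trans_prod_valid |].
rewrite card_prod_valid c1 c2 c3 leq_mul2r; apply/orP; right.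
have le_fm : #|final M1| <= m by rewrite -c1 max_card.
(* With [X] = 2^(n-1), the count (m - f) 2X + f X decreases in f, so f = 1 is the worst case. *)
rewrite e2; move: (2 ^ (n - 1)) f_gt0 le_fm => X; move: #|final M1| => f.
by case: f => // f _ /subnK <-; rewrite addnS subn1 /= -addnS addnK; nia.
Qed.
End Product.
End Generic.

(** * The cyclic successor and predecessor on ordinals *)

Section OrdCycle.
Variable n : nat.
Implicit Types (i j : 'I_n).

Lemma val_ordS i : ordS i = (if i.+1 == n then 0 else i.+1) :> nat.
Proof.
case: eqP => /= [->|ne]; first by rewrite modnn.
by rewrite modn_small //; have := ltn_ord i; lia.
Qed.

Lemma val_ord_pred i :
  ord_pred i = (if i == 0 :> nat then n.-1 else i.-1) :> nat.
Proof.
have lt_in := ltn_ord i; case: eqP => /= [->|ne].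
  by rewrite modn_small // prednK //; lia.
have -> : (i + n).-1 = i.-1 + n by lia.
by rewrite modnDr modn_small //; lia.
Qed.

Lemma val_iter_ordS k i : iter k (@ordS n) i = (i + k) %% n :> nat.
Proof.
elim: k => [|k IH] /=; first by rewrite addn0 modn_small.
by rewrite IH -addn1 modnDml -addnA addn1.
Qed.

Lemma val_iter_ord_pred k i : k <= i -> iter k (@ord_pred n) i = i - k :> nat.
Proof.
elim: k => [|k IH] lt_ki; first by rewrite subn0.
by rewrite iterS val_ord_pred IH ?(ltnW lt_ki) // subn_eq0 leqNgt lt_ki subnS.
Qed.

Lemma iter_ordS_trans i j : exists k, iter k (@ordS n) i = j.
Proof.
exists (j + n - i); apply: val_inj; rewrite /= val_iter_ordS.
have lt_in := ltn_ord i; rewrite subnKC; last by lia.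
by rewrite modnDr modn_small.
Qed.

Lemma imset_ord_predK (S : {set 'I_n}) :
  [set ordS r | r in [set ord_pred r | r in S]] = S.
Proof.
rewrite -imset_comp (eq_imset _ (_ : _ =1 id)) ?imset_id //.
exact: ord_predK.
Qed.
End OrdCycle.

Lemma run_nseq (A : finType) (M : dfa A) (q : state M) k x :
  run q (nseq k x) = iter k (fun r => trans r x) q.
Proof. by elim: k q => // k IH q; rewrite iterSr -IH. Qed.

(** * State complexity of the automata [Xdfa] with a cycle letter *)

Section XdfaTheory.
Variables (n : nat) (n_gt1 : 1 < n) (A : finType) (c : A) (s2 s3 : option A).
Let M := Xdfa n_gt1 (Some c) s2 s3.

Lemma run_cycle (q : state M) k : run q (nseq k c) = iter k (@ordS n) q.
Proof.
by rewrite run_nseq; apply: eq_iter => r; rewrite /= eqxx.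
Qed.

Lemma run_cycle_trans (q r : state M) : exists k, run q (nseq k c) = r.
Proof. by have [k <-] := iter_ordS_trans q r; exists k; apply: run_cycle. Qed.

Lemma run_cycle_inj k : injective (fun q : state M => run q (nseq k c)).
Proof.
move=> q r; rewrite /= !run_cycle.
by elim: k => //= k IH /(can_inj (@ordSK n)).
Qed.

(** The cycle is a transitive permutation: some power takes [q] to the only final state and, being
    injective, takes no other state there. *)
Lemma Xdfa_minimal : minimal M.
Proof.
apply: minimal_dfa => [q|q r ne_qr].
  by have [k] := run_cycle_trans (init M) q; exists (nseq k c).
have lt_n : n.-1 < n by rewrite prednK // (ltnW n_gt1).
have [k eq_k] := run_cycle_trans q (Ordinal lt_n).
exists (nseq k c); rewrite eq_k !inE /= eqxx eq_sym eqb_id.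
apply: contra_neqN ne_qr => /eqP eq_r; apply: (@run_cycle_inj k).
by rewrite eq_k; apply: val_inj.
Qed.

Lemma has_sc_Xdfa : has_sc (lang M) n.
Proof. by exists M; split; [| exact: Xdfa_minimal | rewrite card_ord]. Qed.
End XdfaTheory.

(** * The witness: reachability of all valid states *)

Section Witness.
Variables (o : bool_op) (m n p : nat).
Hypotheses (hm : 2 < m) (hn : 2 < n) (hp : 2 < p).

Let M1 := Xdfa (ltnW hm) (Some a) (Some b) None.
Let M2 := Xdfa (ltnW hn) (Some a) None (Some b).
Let M3 := Xdfa (ltnW hp) (Some b) (Some a) None.
Let D := prod_dfa o M1 M2 M3.

Let zero k (hk : 2 < k) : 'I_k := Ordinal (ltnW (ltnW hk)).
Let one k (hk : 2 < k) : 'I_k := Ordinal (ltnW hk).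
Let swap k (hk : 2 < k) : 'I_k -> 'I_k := tperm (zero hk) (one hk).
Let contract (r : 'I_n) : 'I_n := if r == one hn then zero hn else r.

Lemma swapK k (hk : 2 < k) : involutive (swap hk).
Proof. exact: tpermK. Qed.

Lemma swap_gt1 k (hk : 2 < k) (i : 'I_k) : 1 < i -> swap hk i = i.
Proof.
move=> lt1i; rewrite /swap tpermD // -val_eqE /= neq_ltn ?lt1i //.
by rewrite (ltnW lt1i).
Qed.

Lemma swap_one k (hk : 2 < k) : swap hk (one hk) = zero hk.
Proof. exact: tpermR. Qed.

Lemma swap_zero k (hk : 2 < k) : swap hk (zero hk) = one hk.
Proof. exact: tpermL. Qed.

Lemma ordS_zero k (hk : 2 < k) : ordS (zero hk) = one hk.
Proof.
by apply: ord_inj; rewrite val_ordS (ltn_eqF (ltnW hk : (zero hk).+1 < k)).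
Qed.

Lemma ord_pred_one k (hk : 2 < k) : ord_pred (one hk) = zero hk.
Proof. by rewrite -ordS_zero ordSK. Qed.

Lemma trans_a (x : state D) :
  trans x a = (ordS x.1.1,
               [set ordS r | r in x.1.2] :|: fresh M2 (ordS x.1.1 : state M1),
               swap hp x.2).
Proof. by []. Qed.

Lemma trans_b (x : state D) :
  trans x b = (swap hm x.1.1,
               [set contract r | r in x.1.2]
                 :|: fresh M2 (swap hm x.1.1 : state M1),
               ordS x.2).
Proof. by []. Qed.

Lemma fresh_small (i : 'I_m) : i < m.-1 -> fresh M2 (i : state M1) = set0.
Proof. by move=> lt_i; rewrite /fresh inE ltn_eqF. Qed.

Lemma fresh_last (i : 'I_m) : i = m.-1 :> nat ->
  fresh M2 (i : state M1) = [set zero hn].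
Proof. by move=> i_last; rewrite /fresh inE i_last eqxx. Qed.

Definition reachable (x : state D) := exists w, run (init D) w = x.

Lemma reachable_trans x c : reachable x -> reachable (trans x c).
Proof. by case=> w <-; exists (rcons w c); rewrite run_rcons. Qed.

Lemma contract_id (S : {set 'I_n}) :
  one hn \notin S -> [set contract r | r in S] = S.
Proof.
move=> nS; rewrite -[RHS]imset_id; apply: eq_in_imset => r rS.
by rewrite /contract; case: eqP => // r1; rewrite -r1 rS in nS.
Qed.

(** Reading [ab] takes [M1] from 0 to 1 and back; neither is final since m >= 3, so nothing is
    inserted. The shift by [a] yields [S], which [b] leaves alone because it lacks 1. *)
Lemma reachable_ab (S : {set 'I_n}) k : one hn \notin S ->
  reachable (zero hm, [set ord_pred r | r in S], swap hp (ord_pred k)) ->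
  reachable (zero hm, S, k).
Proof.
move=> nS /(reachable_trans a)/(reachable_trans b).
rewrite trans_b trans_a /= ordS_zero swap_one !fresh_small //=; try lia.
by rewrite !setU0 imset_ord_predK contract_id // swapK ord_predK.
Qed.

(** On [M3], [ab] fixes 1 and cycles 0, 2, 3, ..., p-1. Hence induction along [ab] gives every k
    other than 1, and 1 is then reached from p-1 by [bb], which restores state 0 of [M1]. *)
Lemma reachable_empty k : reachable (zero hm, set0, k).
Proof.
have reach_ne1 : forall i : 'I_p, i != 1 :> nat -> reachable (zero hm, set0, i).
  move=> i; have [c] := ubnP (i : nat); elim: c i => // c IH i lt_ic ne1.
  have [i0|i_gt0] := posnP i.
    have -> : i = zero hp by apply: ord_inj.
    exists [::]; rewrite /= -/D fresh_small //=; lia.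
  apply: reachable_ab; rewrite ?inE // imset0.
  have vi : ord_pred i = i.-1 :> nat by rewrite val_ord_pred gtn_eqF.
  have [i2|ne2] := eqVneq (i : nat) 2.
    have -> : ord_pred i = one hp by apply: ord_inj; rewrite vi i2.
    by rewrite swap_one; apply: IH => //=; lia.
  rewrite swap_gt1 ?vi; last by lia.
  by apply: IH; rewrite vi; lia.
have [k1|] := eqVneq (k : nat) 1; last exact: reach_ne1.
have -> : k = one hp by apply: ord_inj.
have last_ne1 : ord_pred (zero hp) != 1 :> nat.
  by rewrite val_ord_pred /=; lia.
move: (reachable_trans b (reachable_trans b (reach_ne1 _ last_ne1))).
rewrite !trans_b /= swapK swap_zero !imset0 !fresh_small //=; try lia.
by rewrite !setU0 imset0 ord_predK ordS_zero.
Qed.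

Lemma reachable_valid (x : state D) :
  x \in prod_valid o M1 M2 M3 -> reachable x.
Proof.
have [c] := ubnP #|x.1.2|; elim: c x => // c IH [[i S] k] /= ltSc.
move cardS: #|S| ltSc => s; rewrite ltnS => le_sc.
have pred_card (T : {set 'I_n}) : #|[set ord_pred r | r in T]| = #|T|.
  exact/card_imset/ord_pred_inj.
have reach_last (j : 'I_m) (T : {set 'I_n}) l : j = m.-1 :> nat ->
    zero hn \in T -> #|T| = s -> reachable (j, T, l).
  move=> j_last zT cT.
  suff: reachable (ord_pred j, [set ord_pred r | r in T :\ zero hn], swap hp l).
    move/(reachable_trans a); rewrite trans_a /= ord_predK fresh_last //.
    by rewrite imset_ord_predK setUC setD1K // swapK.
  apply: IH => /=.
    by apply: leq_trans le_sc; rewrite pred_card -cT (cardsD1 (zero hn) T) zT.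
  have lt_last : ord_pred j < m.-1.
    by rewrite val_ord_pred j_last; case: eqP => /=; lia.
  rewrite !inE andbT; apply/implyP=> /eqP e.
  by move: lt_last; rewrite -[m.-1]e ltnn.
have reach_zero j (T : {set 'I_n}) l : #|T| = s ->
    iter j (@ordS n) (one hn) \in T -> reachable (zero hm, T, l).
  have one_in (T' : {set 'I_n}) l' : #|T'| = s -> one hn \in T' ->
      reachable (zero hm, T', l').
    move=> cT oT.
    suff: reachable (ord_pred (zero hm), [set ord_pred r | r in T'],
                     swap hp l').
      move/(reachable_trans a); rewrite trans_a /= ord_predK.
      rewrite fresh_small /=; last by lia.
      by rewrite imset_ord_predK setU0 swapK.
    apply: reach_last; rewrite ?pred_card //.
      by rewrite val_ord_pred.
    by rewrite -ord_pred_one; apply: imset_f.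
  (* [j] is the cyclic distance from 1 to an element of [T]; going back along one [ab] shortens it
     by one. *)
  elim: j T l => [|j IHj] T l cT; first exact: one_in.
  have [oT _|oT jT] := boolP (one hn \in T); first exact: one_in.
  apply: reachable_ab => //; apply: IHj; rewrite ?pred_card //.
  by rewrite -[iter _ _ _]ordSK; apply: imset_f.
have reach_small j (T : {set 'I_n}) l : #|T| = s -> j < m.-1 ->
    forall i' : 'I_m, i' = j :> nat -> reachable (i', T, l).
  elim: j T l => [|j IHj] T l cT lt_j i' i'j.
    have -> : i' = zero hm by apply: ord_inj.
    have [->|[t tT]] := set_0Vmem T; first exact: reachable_empty.
    have [k' k't] := iter_ordS_trans (one hn) t.
    by apply: (reach_zero k') => //; rewrite k't.
  suff: reachable (ord_pred i', [set ord_pred r | r in T], swap hp l).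
    move/(reachable_trans a); rewrite trans_a /= ord_predK fresh_small ?i'j //.
    by rewrite imset_ord_predK setU0 swapK.
  by apply: IHj; rewrite ?pred_card ?val_ord_pred ?i'j // ltnW.
rewrite !inE /= andbT; have [i_last|i_small] := eqVneq (i : nat) m.-1.
  by move=> /= zS; apply: reach_last.
move=> _; apply: (reach_small i) => //.
by have := ltn_ord i; move: i_small => /=; lia.
Qed.

(** * The witness: distinguishability *)

Let top : 'I_n := ord_pred (zero hn).
Let top3 : 'I_p := ord_pred (zero hp).

Lemma val_top : top = n.-1 :> nat. Proof. by rewrite val_ord_pred. Qed.

Lemma val_top3 : top3 = p.-1 :> nat. Proof. by rewrite val_ord_pred. Qed.

Lemma acceptE (x : state D) :
  (x \in final D) = bool_of o (top \in x.1.2) (x.2 == top3).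
Proof.
rewrite inE; congr (bool_of o _ _).
  apply/exists_inP/idP => [[r rS] | tS].
    rewrite inE -val_top => /eqP r_top.
    by have <- : r = top by apply: ord_inj.
  by exists top; rewrite // inE val_top.
by rewrite inE -val_top3.
Qed.

Lemma mem_fresh_gt0 (i : state M1) (q : 'I_n) : 0 < q ->
  (q \in fresh M2 i) = false.
Proof.
move=> q_gt0; rewrite /fresh; case: ifP => _; rewrite inE //.
by rewrite -val_eqE /= gtn_eqF.
Qed.

Lemma mem_trans_a (x : state D) (q : 'I_n) : 0 < q ->
  (q \in (trans x a).1.2) = (ord_pred q \in x.1.2).
Proof.
move=> q_gt0; rewrite trans_a /= in_setU mem_fresh_gt0 // orbF.
by rewrite -{1}[q]ord_predK mem_imset //; apply: ordS_inj.
Qed.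

Lemma mem_trans_b (x : state D) (q : 'I_n) : 0 < q ->
  (q \in (trans x b).1.2) = (1 < q) && (q \in x.1.2).
Proof.
move=> q_gt0; rewrite trans_b /= in_setU mem_fresh_gt0 // orbF.
apply/imsetP/andP => [[r rS] | [q_gt1 qS]].
  rewrite /contract; case: eqP => [_ q0 | ne_r1 qr].
    by rewrite q0 in q_gt0.
  rewrite -qr in rS ne_r1.
  split=> //; suff : (q : nat) != 1 by lia.
  by apply/eqP=> q1; case: ne_r1; apply: ord_inj.
exists q => //; rewrite /contract; case: eqP => // q1.
by rewrite q1 in q_gt1.
Qed.

(** A 0 inserted during these [k] steps gets at most to k-1, below [q], so membership of [q] depends
    on the original set only. *)
Lemma mem_run_a (x : state D) (q : 'I_n) k : k <= q ->
  (q \in (run x (nseq k a)).1.2) = (iter k (@ord_pred n) q \in x.1.2).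
Proof.
elim: k q => // k IH q lt_kq.
rewrite run_nseq iterS -run_nseq mem_trans_a ?(leq_trans _ lt_kq) // iterSr IH //.
by rewrite val_ord_pred gtn_eqF ?(leq_trans _ lt_kq) //; lia.
Qed.

Lemma mem_run_b (x : state D) k :
  (top \in (run x (nseq k b)).1.2) = (top \in x.1.2).
Proof.
elim: k => // k IH; have n_gt2 := hn.
rewrite run_nseq iterS -run_nseq mem_trans_b val_top; last by lia.
by rewrite IH andb_idl // => _; lia.
Qed.

Definition ab k : seq bool := flatten (nseq k [:: a; b]).

Lemma run_ab (M : dfa bool) (q : state M) k :
  run q (ab k) = iter k (fun r => trans (trans r a) b) q.
Proof. by elim: k q => // k IH q; rewrite iterSr -IH. Qed.

(** Each round raises the lower bound on positive elements by one: [a] shifts them, and an element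
    arriving at 1 is sent to 0 by [b]. *)
Lemma mem_run_ab (x : state D) (q : 'I_n) k :
  q \in (run x (ab k)).1.2 -> 0 < q -> k < q.
Proof.
elim: k q => // k IH q; rewrite run_ab iterS -run_ab => + q_gt0.
rewrite mem_trans_b // => /andP[q_gt1]; rewrite mem_trans_a // => /IH.
by rewrite val_ord_pred gtn_eqF //; lia.
Qed.

Lemma top_run_ab (x : state D) k : n.-1 <= k -> top \notin (run x (ab k)).1.2.
Proof.
move=> le_nk; apply/negP => /mem_run_ab; rewrite val_top.
by have := hn; lia.
Qed.

Definition distinguished (x y : state D) :=
  exists w, (run x w \in final D) != (run y w \in final D).

Lemma distinguished_sym x y : distinguished x y -> distinguished y x.
Proof. by case=> w; rewrite eq_sym; exists w. Qed.

Lemma distinguished_run x y w :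
  distinguished (run x w) (run y w) -> distinguished x y.
Proof. by case=> v; rewrite -!run_cat; exists (w ++ v). Qed.

Lemma distinguished_set (x y : state D) (s : 'I_n) :
  x.2 = y.2 -> s \in x.1.2 -> s \notin y.1.2 -> distinguished x y.
Proof.
move=> eq3 sx sy; apply: (@distinguished_run _ _ (nseq (n.-1 - s) a)).
have le_n : n.-1 - s <= top by rewrite val_top leq_subr.
have iter_top : iter (n.-1 - s) (@ord_pred n) top = s.
  apply: ord_inj; rewrite val_iter_ord_pred // val_top subKn //.
  by have := ltn_ord s; lia.
move: (mem_run_a x le_n) (mem_run_a y le_n); rewrite iter_top sx (negPf sy).
have : (run x (nseq (n.-1 - s) a)).2 = (run y (nseq (n.-1 - s) a)).2.
  by rewrite !run_prod_snd eq3.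
move: (run x _) (run y _) => {x y sx sy eq3} x y eq3 topx topy.
(* Exactly one set now contains [top]. An accepting third component exposes this under intersection,
   a rejecting one under union and symmetric difference. *)
pose target : state M3 := if o is Inter then top3 else zero hp.
have [k eq_k] := @run_cycle_trans _ (ltnW hp) _ b (Some a) None y.2 target.
exists (nseq k b); rewrite !acceptE !mem_run_b topx topy !run_prod_snd eq3 eq_k.
have zero_top3 : (zero hp == top3) = false.
  rewrite -val_eqE; apply/negbTE; rewrite neq_ltn [X in _ < X]val_top3 /=.
  by have := hp; lia.
by rewrite /target; case: (o); rewrite ?eqxx ?zero_top3.
Qed.

Lemma distinguished_third (x y : state D) : x.2 != y.2 -> distinguished x y.
Proof.
move=> ne3.
have neq_run (w : seq bool) : (run x w).2 != (run y w).2.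
  rewrite !run_prod_snd; apply: contraNneq ne3.
  elim/last_ind: w => [/= ->|w c IH] //.
  rewrite !run_rcons => eq_run; apply: IH.
  case: c eq_run; first by apply: perm_inj.
  exact: ordS_inj.
(* Both letters permute the states of [M3], so the third components stay distinct. It remains to
   find a word after which the sets do not mask this difference; a power of [b] then makes only the
   third component of [x] final. *)
suff [w topw] : exists w, if o is Inter then top \in (run x w).1.2
    else (top \notin (run x w).1.2) && (top \notin (run y w).1.2).
  apply: (@distinguished_run _ _ w).
  have [k eq_k] :=
    @run_cycle_trans _ (ltnW hp) _ b (Some a) None (run x w).2 top3.
  have acc z : (run (run z w) (nseq k b) \in final D) =
      bool_of o (top \in (run z w).1.2) (run (run z w).2 (nseq k b) == top3).
    by rewrite acceptE mem_run_b run_prod_snd.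
  have ne_y : (run (run y w).2 (nseq k b) == top3) = false.
    rewrite -eq_k; apply/negbTE; apply: contraNneq (neq_run w) => eq_xy.
    by rewrite (@run_cycle_inj _ (ltnW hp) _ b (Some a) None k _ _ eq_xy).
  exists (nseq k b); rewrite !acc eq_k ne_y eqxx.
  case: (o) topw => [->|/andP[/negPf-> /negPf->]|/andP[/negPf-> /negPf->]];
  by rewrite /= ?andbF.
case: (o); try by exists (ab n.-1); rewrite !top_run_ab.
(* Intersection: [k.+1] letters [a] bring [M1] to its final state and insert 0, which n-1 more carry
   to [top]. *)
have [k eq_k] := iter_ordS_trans (ordS x.1.1) (ord_pred (zero hm)).
exists (nseq k.+1 a ++ nseq n.-1 a); rewrite run_cat mem_run_a ?val_top //.
have -> : iter n.-1 (@ord_pred n) top = zero hn.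
  by apply: ord_inj; rewrite val_iter_ord_pred val_top ?subnn.
rewrite run_nseq iterS -run_nseq trans_a /= in_setU fresh_last ?set11 ?orbT //.
have -> : (run x (nseq k a)).1.1 = iter k (@ordS m) x.1.1.
  by rewrite run_prod_fst; apply: run_cycle.
by rewrite -iterS iterSr eq_k val_ord_pred.
Qed.

(** The action of [ab] on [M1]: it fixes 0 and cycles 1, ..., m-1. *)
Let turn (i : 'I_m) : 'I_m := swap hm (ordS i).

Lemma turn_zero : turn (zero hm) = zero hm.
Proof. by rewrite /turn ordS_zero swap_one. Qed.

Lemma turn_inj : injective turn.
Proof. by move=> i j /perm_inj/ordS_inj. Qed.

Lemma iter_turn_neq0 k i : i != zero hm -> iter k turn i != zero hm.
Proof.
elim: k => //= k IH /IH; apply: contraNneq => eq0.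
by apply/eqP/turn_inj; rewrite eq0 turn_zero.
Qed.

(** The target is m-2 because one more [a] then enters the final state of [M1]. *)
Lemma iter_turn_reach i : i != zero hm ->
  exists k, iter k turn i = m - 2 :> nat.
Proof.
have up d (j : 'I_m) : 0 < j -> j + d = m - 2 -> iter d turn j = m - 2 :> nat.
  elim: d j => [|d IH] j j_gt0 eq_j; first by rewrite -eq_j addn0.
  have vj : turn j = j.+1 :> nat.
    have vS : ordS j = j.+1 :> nat by rewrite val_ordS ltn_eqF //; lia.
    by rewrite /turn swap_gt1 vS.
  by rewrite iterSr IH // vj //; lia.
move=> ne0; have i_gt0 : 0 < i by rewrite lt0n.
have lt_im := ltn_ord i; have [i_last|i_small] := eqVneq (i : nat) m.-1.
  have -> : i = ord_pred (zero hm) by apply: ord_inj; rewrite val_ord_pred.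
  (* From m-1 one turn leads to 1, and m-3 further turns to m-2. *)
  exists (m - 3).+1; rewrite iterSr; apply: up; rewrite /turn;
    rewrite ord_predK swap_zero //=; lia.
by exists (m - 2 - i); apply: up => //; lia.
Qed.

Lemma distinguished_first_zero (x y : state D) :
  x.2 = y.2 -> x.1.1 != zero hm -> y.1.1 = zero hm -> distinguished x y.
Proof.
move=> eq3 x_ne0 y0.
have [k eq_k] := iter_turn_reach (iter_turn_neq0 n.-1 x_ne0).
(* At least n-1 rounds remove [top] from the set of [y], and the [k] others adjust [M1] on the side
   of [x]. The next [a] inserts 0 for [x]; for [y] it moves [M1] to 1, and 0 could only come from
   the missing [top]. *)
pose w := ab (k + n.-1).
have run1 (z : state D) : (run z w).1.1 = iter (k + n.-1) turn z.1.1.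
  by rewrite run_prod_fst run_ab.
have x1 : (run x w).1.1 = m - 2 :> nat by rewrite run1 iterD.
have y1 : (run y w).1.1 = zero hm.
  by rewrite run1 y0; elim: (k + n.-1) => //= l ->; apply: turn_zero.
have topy : top \notin (run y w).1.2 by apply: top_run_ab; apply: leq_addl.
have eq3w : (run x w).2 = (run y w).2 by rewrite !run_prod_snd eq3.
apply: (@distinguished_run _ _ w); apply: (@distinguished_run _ _ [:: a]).
apply: (@distinguished_set _ _ (zero hn)).
- by rewrite /run /= -!/(run _ _) eq3w.
- rewrite [run _ [:: a]]trans_a /= in_setU fresh_last ?set11 ?orbT //.
  by rewrite val_ordS x1 ltn_eqF; have := hm; lia.
- rewrite [run _ [:: a]]trans_a /= y1 ordS_zero.
  rewrite fresh_small ?setU0 /=; last by lia.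
  by rewrite -[zero hn]ord_predK mem_imset //; apply: ordS_inj.
Qed.

Lemma distinguished_first (x y : state D) :
  x.2 = y.2 -> x.1.1 != y.1.1 -> distinguished x y.
Proof.
move=> eq3 ne1.
have [k eq_k] := @run_cycle_trans _ (ltnW hm) _ a (Some b) None y.1.1 (zero hm).
apply: (@distinguished_run _ _ (nseq k a)); apply: distinguished_first_zero.
- by rewrite !run_prod_snd eq3.
- rewrite run_prod_fst -eq_k; apply: contraNneq ne1 => eq_xy.
  by rewrite (@run_cycle_inj _ (ltnW hm) _ a (Some b) None k _ _ eq_xy).
- by rewrite run_prod_fst.
Qed.

Lemma distinguished_neq (x y : state D) : x != y -> distinguished x y.
Proof.
move=> ne_xy; have [eq3|] := eqVneq x.2 y.2; last exact: distinguished_third.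
have [eq1|] := eqVneq x.1.1 y.1.1; last exact: distinguished_first.
have [sub_xy|/subsetPn[s]] := boolP (x.1.2 \subset y.1.2); last first.
  exact: distinguished_set.
have [sub_yx|/subsetPn[s sy sx]] := boolP (y.1.2 \subset x.1.2); last first.
  exact/distinguished_sym/(distinguished_set (esym eq3) sy sx).
case/eqP: ne_xy.
case: x y eq1 eq3 sub_xy sub_yx => [[i S] k] [[j T] l] /= -> -> ST TS.
by congr (_, _, _); apply/eqP; rewrite eqEsubset ST.
Qed.

Lemma has_sc_witness :
  has_sc (conc_bool o (lang M1) (lang M2) (lang M3))
    (((m - 1) * 2 ^ n + 2 ^ (n - 1)) * p).
Proof.
pose V := prod_valid o M1 M2 M3.
pose iV := init_prod_valid o M1 M2 M3.
pose tV := @trans_prod_valid _ o M1 M2 M3.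
apply: eq_has_sc (lang_prod_dfa o M1 M2 M3) _.
exists (sub_dfa iV tV); split; first exact: lang_sub_dfa.
  move=> N NM; rewrite card_sub_dfa; apply: (@leq_card_states _ D).
  - by move=> w; rewrite NM lang_sub_dfa.
  - exact: reachable_valid.
  - by move=> q r _ _; apply: distinguished_neq.
rewrite card_sub_dfa card_prod_valid !card_ord.
have -> : #|final M1| = 1.
  rewrite -(cards1 (ord_pred (zero hm))); apply: eq_card => i.
  by rewrite !inE -val_eqE -[m.-1](val_ord_pred (zero hm)).
by rewrite mul1n.
Qed.

End Witness.

Theorem theorem4 (o : bool_op) (m n p : nat)
    (hm : 3 <= m) (hn : 3 <= n) (hp : 3 <= p) :
  let N := ((m - 1) * 2 ^ n + 2 ^ (n - 1)) * p in
  let L1 : language bool := lang (Xdfa (ltnW hm) (Some a) (Some b) None) in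
  let L2 : language bool := lang (Xdfa (ltnW hn) (Some a) None (Some b)) in
  let L3 : language bool := lang (Xdfa (ltnW hp) (Some b) (Some a) None) in
  has_sc_op (conc_bool o) m n p N /\
  [/\ has_sc L1 m, has_sc L2 n, has_sc L3 p &
      has_sc (bool_lang o (conc L1 L2) L3) N].
Proof.
move=> N L1 L2 L3.
have sc1 : has_sc L1 m by apply: has_sc_Xdfa.
have sc2 : has_sc L2 n by apply: has_sc_Xdfa.
have sc3 : has_sc L3 p by apply: has_sc_Xdfa.
have scN : has_sc (bool_lang o (conc L1 L2) L3) N by apply: has_sc_witness.
split=> //; split; first by exists bool, L1, L2, L3.
move=> A K1 K2 K3 [M1 [e1 _ c1]] [M2 [e2 _ c2]] [M3 [e3 _ c3]].
have [k sck le_k] := has_sc_prod_leq o (ltnW hm) c1 c2 c3.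
by exists k => //; apply: eq_has_sc sck; apply: eq_conc_bool.
Qed.
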